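(* Let $\kappa$ be a regular infinite cardinal and $\mu$ a singular cardinal with $\mathrm{cf}(\mu)=\kappa$. The spaces $({}^{\mu}2,\kappa)$ and $({}^{\mu}\kappa,\kappa)$ are homeomorphic if and only if $\kappa$ is not weakly compact.
   Context: For ordinals $\delta,\rho$, ${}^{\delta}\rho$ is the set of functions $\delta\to\rho$; for a partial function $s\colon\delta\rightharpoonup\rho$, $[s]=\{f\in{}^{\delta}\rho: s\subseteq f\}$. The ${<}\kappa$-box topology on ${}^{\delta}\rho$ has base $\{[s]: |\mathrm{dom}(s)|<\kappa\}$; $(X,\kappa)$ denotes $X$ with this topology. A space is ${<}\kappa$-compact if every open cover has a subcover of cardinality $<\kappa$. An infinite cardinal $\kappa$ is called weakly compact if $({}^{\kappa}2,\kappa)$ is ${<}\kappa$-compact (in particular $\aleph_0$ counts as weakly compact). *)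

(* Defs.v *)
(* Cardinals are modelled as types carrying a well-order
   that is an initial ordinal (von Neumann cardinal). *)
From Stdlib Require Import Classical.

Definition injective {A B : Type} (f : A -> B) : Prop :=
  forall x y, f x = f y -> x = y.

Definition card_le (A B : Type) : Prop := exists f : A -> B, injective f.
(* |A| < |B|  (with AC, cardinals are linearly ordered) *)
Definition card_lt (A B : Type) : Prop := ~ card_le B A.

Definition well_order {T : Type} (lt : T -> T -> Prop) : Prop :=
  (forall x, ~ lt x x) /\
  (forall x y z, lt x y -> lt y z -> lt x z) /\
  (forall x y, lt x y \/ x = y \/ lt y x) /\
  well_founded lt.

Definition is_cardinal (T : Type) (lt : T -> T -> Prop) : Prop :=
  well_order lt /\ forall x : T, ~ card_le T {y : T | lt y x}.

Definition infinite (T : Type) : Prop := card_le nat T.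

Definition cofinal {T : Type} (lt : T -> T -> Prop) (C : T -> Prop) : Prop :=
  forall x, exists y, C y /\ ~ lt y x.

Definition cofinality_is (T : Type) (lt : T -> T -> Prop) (K : Type) : Prop :=
  (exists C, cofinal lt C /\ card_le {y | C y} K /\ card_le K {y | C y}) /\
  (forall C, cofinal lt C -> card_le K {y | C y}).

Definition regular (T : Type) (lt : T -> T -> Prop) : Prop :=
  infinite T /\ cofinality_is T lt T.

Definition singular (T : Type) (lt : T -> T -> Prop) : Prop :=
  infinite T /\ exists C, cofinal lt C /\ card_lt {y | C y} T.

(* Open sets of the <kappa-box topology on D -> R (kappa = |K|):
   the topology generated by the base { [s] : |dom s| < kappa }. *)
Definition box_open (D R K : Type) (U : (D -> R) -> Prop) : Prop :=
  forall x, U x -> exists A : D -> Prop,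
    card_lt {d | A d} K /\ forall g, (forall d, A d -> g d = x d) -> U g.

Definition box_continuous (D R D' R' K : Type) (f : (D -> R) -> (D' -> R')) : Prop :=
  forall V, box_open D' R' K V -> box_open D R K (fun x => V (f x)).

Definition box_homeomorphic (D R D' R' K : Type) : Prop :=
  exists (f : (D -> R) -> (D' -> R')) (g : (D' -> R') -> (D -> R)),
    (forall x, g (f x) = x) /\ (forall y, f (g y) = y) /\
    box_continuous D R D' R' K f /\ box_continuous D' R' D R K g.

Definition box_lt_compact (D R K : Type) : Prop :=
  forall Cov : ((D -> R) -> Prop) -> Prop,
    (forall U, Cov U -> box_open D R K U) ->
    (forall x, exists U, Cov U /\ U x) ->
    exists Sub : ((D -> R) -> Prop) -> Prop,
      (forall U, Sub U -> Cov U) /\ card_lt {U | Sub U} K /\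
      (forall x, exists U, Sub U /\ U x).

Definition weakly_compact (K : Type) : Prop :=
  infinite K /\ box_lt_compact K bool K.

(* Main.v *)
(** If [2^K] is not <K-compact, the minimal initial segments deciding a bad cover partition
    it into at least [K] clopen copies of itself.  Since [K * S] has the size of [S] for
    [K <= S], this gives [2^K = K * 2^K] with [K] discrete, and absorption does the rest:
    [2^M = (2^K)^M = (K * 2^K)^M = K^M * 2^M = (K * 2)^M = K^M].

    Conversely [K^M] maps continuously onto the discrete space [K], so it is enough that
    [2^M] does not when [2^K] is <K-compact.  Compactness makes [2^A] small for small [A];
    closing off in [K] steps yields a set of at most [K] coordinates on which a continuous
    surjection [2^M -> K] is already decided, i.e. a partition of [2^K] into [K] nonempty
    open sets. *)
From mathcomp.classical Require classical_sets.
From Stdlib Require Import Classical ClassicalEpsilon IndefiniteDescription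
  FunctionalExtensionality ProofIrrelevance.
Require Import Defs.

(** * Comparison of cardinals and well-founded recursion *)

Lemma card_le_trans (A B C : Type) : card_le A B -> card_le B C -> card_le A C.
Proof.
  intros [f Hf] [g Hg]. exists (fun x => g (f x)).
  intros x y E. apply Hf, Hg, E.
Qed.

Lemma card_le_lt_trans (A B C : Type) : card_le A B -> card_lt B C -> card_lt A C.
Proof.
  intros H1 H2 H3. apply H2. exact (card_le_trans _ _ _ H3 H1).
Qed.

Lemma proj1_sig_injective (D : Type) (P : D -> Prop) : injective (@proj1_sig D P).
Proof.
  intros [x p] [y q]; simpl; intros <-. f_equal. apply proof_irrelevance.
Qed.

Lemma surjective_card_le (A B : Type) (f : B -> A) :
  (forall a, exists b, f b = a) -> card_le A B.
Proof.
  intros H. destruct (functional_choice _ H) as [g Hg].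
  exists g. intros x y E. rewrite <- (Hg x), <- (Hg y), E. reflexivity.
Qed.

(** Schröder-Bernstein: [C] is the least set that contains the points outside the range of [v] and
    is closed under [u] followed by [v]. The bijection is [u] on [C] and the inverse of [v] off
    [C]. *)
Lemma card_le_bijection (A B : Type) :
  card_le A B -> card_le B A ->
  exists (f : A -> B) (g : B -> A), (forall x, g (f x) = x) /\ (forall y, f (g y) = y).
Proof.
  intros [u Hu] [v Hv].
  pose (C := fun x => forall P : A -> Prop,
    (forall a, (forall b, v b <> a) -> P a) ->
    (forall a, P a -> P (v (u a))) -> P x).
  assert (C0 : forall a, (forall b, v b <> a) -> C a) by (intros a Ha P H0 _; auto).
  assert (CS : forall a, C a -> C (v (u a))).
  { intros a Ha P H0 H1. apply H1. apply Ha; assumption. }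
  assert (Cinv : forall b, C (v b) -> exists a, C a /\ u a = b).
  { intros b Hb.
    (* Stated through the equation [v b = v b'], the claim becomes a property of the point [v b]
       alone, as elimination of [C] requires; membership in [C] is carried along. *)
    assert (H : C (v b) /\ forall b', v b = v b' -> exists a, C a /\ u a = b').
    { apply Hb.
      - intros a Ha. split; [auto|]. intros b' E. exfalso. exact (Ha b' (eq_sym E)).
      - intros a [Ha _]. split; [auto|]. intros b' E. exists a. split; [exact Ha|].
        exact (Hv _ _ E). }
    apply H. reflexivity. }
  assert (Hf : forall a, exists b, (C a /\ u a = b) \/ (~ C a /\ v b = a)).
  { intros a. destruct (classic (C a)) as [H|H]; [eauto|].
    destruct (classic (exists b, v b = a)) as [[b Hb]|N]; [eauto|].
    exfalso. apply H, C0. intros b Hb. apply N. eauto. }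
  destruct (functional_choice _ Hf) as [f Ff].
  assert (Hg : forall b, exists a, f a = b).
  { intros b. destruct (classic (C (v b))) as [H|H].
    - destruct (Cinv b H) as [a [Ha Hb]]. exists a.
      destruct (Ff a) as [[_ E]|[N _]]; [congruence|contradiction].
    - exists (v b). destruct (Ff (v b)) as [[N _]|[_ E]]; [contradiction|auto]. }
  destruct (functional_choice _ Hg) as [g Fg].
  exists f, g. split; [|exact Fg].
  assert (If : injective f).
  { intros x y E. destruct (Ff x) as [[Cx Ex]|[Cx Ex]], (Ff y) as [[Cy Ey]|[Cy Ey]].
    - apply Hu. congruence.
    - exfalso. apply Cy. rewrite <- Ey, <- E, <- Ex. auto.
    - exfalso. apply Cx. rewrite <- Ex, E, <- Ey. auto.
    - congruence. }
  intros x. apply If. apply Fg.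
Qed.

(** Transfinite recursion: [h t] is chosen outside the values already taken at the predecessors of
    [t]. *)
Lemma greedy_choice (T Y : Type) (R : T -> T -> Prop) :
  well_founded R ->
  (forall t (g : {s | R s t} -> Y), exists y, forall s, g s <> y) ->
  exists h : T -> Y, forall s t, R s t -> h s <> h t.
Proof.
  intros wf H.
  pose (F := fun t (rec : forall s, R s t -> Y) =>
    proj1_sig (constructive_indefinite_description _
      (H t (fun s => rec (proj1_sig s) (proj2_sig s))))).
  exists (Fix wf (fun _ => Y) F). intros s t Hst.
  rewrite (Fix_eq wf (fun _ => Y) F) with (x := t).
  - unfold F at 2.
    destruct (constructive_indefinite_description _ _) as [y Hy]. simpl.
    exact (Hy (exist _ s Hst)).
  - intros x f g E. f_equal. extensionality y. extensionality p. apply E.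
Qed.

(** For transitive [R] the solution is an increasing chain; the closing-off argument under
    compactness builds its sets of coordinates this way. *)
Lemma well_founded_rec_predicate (T D : Type) (R : T -> T -> Prop)
  (F : T -> (D -> Prop) -> D -> Prop) :
  well_founded R ->
  exists A : T -> D -> Prop, forall t d, A t d <-> exists s, R s t /\ F s (A s) d.
Proof.
  intros wf.
  pose (G := fun t (rec : forall s, R s t -> D -> Prop) (d : D) =>
    exists s (p : R s t), F s (rec s p) d).
  exists (Fix wf (fun _ => D -> Prop) G). intros t d.
  rewrite (Fix_eq wf (fun _ => D -> Prop) G).
  - unfold G at 1. split; intros [s [p q]]; exists s; eauto.
  - intros x f g E. f_equal. extensionality y. extensionality p. apply E.
Qed.

(** * Sets of size less than [K], for a regular cardinal [K] *)

Definition small (K : Type) {D : Type} (A : D -> Prop) : Prop := card_lt {d | A d} K.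

Section SmallSets.
Context (K : Type) (lt : K -> K -> Prop).
Context (HK : is_cardinal K lt) (Hreg : regular K lt).

Let lt_irrefl : forall x, ~ lt x x := proj1 (proj1 HK).
Let lt_trans : forall x y z, lt x y -> lt y z -> lt x z := proj1 (proj2 (proj1 HK)).
Let lt_total : forall x y, lt x y \/ x = y \/ lt y x :=
  proj1 (proj2 (proj2 (proj1 HK))).
Let lt_wf : well_founded lt := proj2 (proj2 (proj2 (proj1 HK))).

Lemma small_image (D D' : Type) (A : D -> Prop) (B : D' -> Prop) (f : D -> D') :
  small K A -> (forall d', B d' -> exists d, A d /\ f d = d') -> small K B.
Proof.
  intros HA H. apply card_le_lt_trans with (2 := HA).
  assert (H' : forall b : {d' | B d'}, exists a : {d | A d}, f (proj1_sig a) = proj1_sig b).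
  { intros [d' p]. destruct (H d' p) as [d [q E]]. exists (exist _ d q). exact E. }
  destruct (functional_choice _ H') as [g Hg]. exists g.
  intros x y E. apply proj1_sig_injective. rewrite <- Hg, <- Hg, E. reflexivity.
Qed.

Lemma small_subset (D : Type) (A B : D -> Prop) :
  small K A -> (forall d, B d -> A d) -> small K B.
Proof.
  intros HA H. apply (small_image _ _ A B (fun d => d)); [exact HA|]. eauto.
Qed.

Lemma small_range (T D : Type) (f : T -> D) :
  card_lt T K -> small K (fun d => exists t, f t = d).
Proof.
  intros HT. apply card_le_lt_trans with (2 := HT).
  assert (H : forall b : {d | exists t, f t = d}, exists t, f t = proj1_sig b).
  { intros [d p]. exact p. }
  destruct (functional_choice _ H) as [g Hg]. exists g.
  intros x y E. apply proj1_sig_injective. rewrite <- Hg, <- Hg, E. reflexivity.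
Qed.

Lemma segment_small (x : K) : small K (fun y => lt y x).
Proof. exact (proj2 HK x). Qed.

(** This is regularity: a set without a strict upper bound is cofinal, hence of size at least
    [K]. *)
Lemma small_bounded (C : K -> Prop) : small K C -> exists x, forall y, C y -> lt y x.
Proof.
  intros HC. apply NNPP. intros N. apply HC.
  apply (proj2 (proj2 Hreg)). intros x. apply NNPP. intros N'. apply N. exists x.
  intros y Hy. apply NNPP. intros N''. apply N'. eauto.
Qed.

Lemma two_points : exists a b : K, a <> b.
Proof.
  destruct Hreg as [[f Hf] _]. exists (f 0), (f 1). intros E.
  discriminate (Hf _ _ E).
Qed.

Lemma small_singleton (D : Type) (a : D) : small K (fun d => d = a).
Proof.
  intros [f Hf]. destruct two_points as [x [y N]]. apply N, Hf.
  apply proj1_sig_injective.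
  exact (eq_trans (proj2_sig (f x)) (eq_sym (proj2_sig (f y)))).
Qed.

Lemma lt_unbounded (x : K) : exists y, lt x y.
Proof.
  destruct (small_bounded _ (small_singleton _ x)) as [y Hy]. eauto.
Qed.

Lemma lt_directed (x y : K) : exists z, lt x z /\ lt y z.
Proof.
  destruct (lt_unbounded x) as [x' Hx], (lt_unbounded y) as [y' Hy].
  destruct (lt_total x' y') as [H|[H|H]].
  - exists y'. eauto.
  - subst. eauto.
  - exists x'. eauto.
Qed.

Lemma closed_segment_small (x : K) : small K (fun y => ~ lt x y).
Proof.
  destruct (lt_unbounded x) as [z Hz].
  apply (small_subset _ _ _ (segment_small z)). intros y Hy.
  destruct (lt_total x y) as [H|[H|H]]; [contradiction|subst; auto|eauto].
Qed.

(** An injection [e] of [K] into the union assigns to each [k] an index [c k]. The fibres of [c] are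
    small, hence bounded, and the bounds all lie below one [z]. But [z] lies in the fibre over
    [c z], so [z] is below itself. *)
Lemma small_union (I D : Type) (P : I -> Prop) (B : I -> D -> Prop) :
  small K P -> (forall i, P i -> small K (B i)) ->
  small K (fun d => exists i, P i /\ B i d).
Proof.
  intros HP HB [e He].
  assert (Hi : forall k, exists i, P i /\ B i (proj1_sig (e k))).
  { intros k. exact (proj2_sig (e k)). }
  destruct (functional_choice _ Hi) as [c Hc].
  assert (Hx : forall i, exists x, forall k, P i -> c k = i -> lt k x).
  { intros i. destruct (classic (P i)) as [p|N].
    - destruct (small_bounded (fun k => c k = i)) as [x Hx]; [|eauto].
      apply card_le_lt_trans with (2 := HB i p).
      assert (q : forall k : {k | c k = i}, B i (proj1_sig (e (proj1_sig k)))).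
      { intros [k E]. simpl. rewrite <- E. apply Hc. }
      exists (fun k => exist (B i) _ (q k)). intros x y E.
      apply proj1_sig_injective, He, proj1_sig_injective.
      exact (f_equal (@proj1_sig _ _) E).
    - destruct two_points as [x _]. exists x. tauto. }
  destruct (functional_choice _ Hx) as [b Hb].
  destruct (small_bounded (fun z => exists i, P i /\ b i = z)) as [z Hz].
  { apply (small_image _ _ P _ b HP). auto. }
  destruct (Hc z) as [Pz _].
  apply (lt_irrefl z), lt_trans with (b (c z)); eauto.
Qed.

(** Two points of a proper initial segment of [K] serve as indices, which reduces the claim to small
    unions. *)
Lemma small_or (D : Type) (A B : D -> Prop) :
  small K A -> small K B -> small K (fun d => A d \/ B d).
Proof.
  intros HA HB. destruct two_points as [a [b N]].
  destruct (lt_directed a b) as [z [az bz]].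
  assert (H := small_union K D (fun x => lt x z)
    (fun i d => (i = a /\ A d) \/ (i = b /\ B d)) (segment_small z)).
  eapply small_subset; [apply H|].
  - intros i _. destruct (classic (i = a)) as [E|E].
    + apply (small_subset _ _ _ HA). intros d [[_ p]|[q _]]; [exact p|congruence].
    + apply (small_subset _ _ _ HB). intros d [[p _]|[_ q]]; [congruence|exact q].
  - intros d [p|p]; [exists a|exists b]; auto.
Qed.

(** * Cardinal arithmetic: comparability and absorption of products *)

(** Embed [K] greedily into [A]. If this gets stuck at [k], the segment below [k] maps onto [A]. *)
Lemma card_le_comparable (A : Type) : card_le A K \/ card_le K A.
Proof.
  destruct (classic (forall k (g : {s | lt s k} -> A), exists y, forall s, g s <> y))
    as [H|H].
  - right. destruct (greedy_choice _ _ _ lt_wf H) as [h Hh]. exists h.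
    intros x y E. destruct (lt_total x y) as [L|[L|L]]; [|exact L|];
      exfalso; apply (Hh _ _ L); congruence.
  - left. apply not_all_ex_not in H. destruct H as [k H].
    apply not_all_ex_not in H. destruct H as [g H].
    apply card_le_trans with {s | lt s k}.
    + apply (surjective_card_le _ _ g). intros a. apply NNPP. intros N. apply H.
      exists a. intros s E. apply N. eauto.
    + exists (@proj1_sig _ _). apply proj1_sig_injective.
Qed.

Lemma card_lt_card_le (A : Type) : card_lt A K -> card_le A K.
Proof.
  intros H. destruct (card_le_comparable A); [assumption|contradiction].
Qed.

(* [T] is well-ordered with small initial segments by comparing first the ranks
   and then the images under injections of the small fibres into [K]. *)
Lemma small_fibres_card_le (T : Type) (r : T -> K) :
  (forall k, small K (fun t => r t = k)) -> card_le T K.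
Proof.
  intros Hr.
  assert (Hj : forall k, exists j : T -> K,
    forall s t, r s = k -> r t = k -> j s = j t -> s = t).
  { intros k. destruct (card_lt_card_le _ (Hr k)) as [e He].
    exists (fun t => match excluded_middle_informative (r t = k) with
                     | left p => e (exist _ t p) | right _ => k end).
    intros s t Es Et.
    destruct (excluded_middle_informative (r s = k)) as [ps|]; [|contradiction].
    destruct (excluded_middle_informative (r t = k)) as [pt|]; [|contradiction].
    intros E. apply He in E. exact (f_equal (@proj1_sig _ _) E). }
  destruct (functional_choice _ Hj) as [j Ij].
  pose (R := fun s t => lt (r s) (r t) \/ (r s = r t /\ lt (j (r t) s) (j (r t) t))).
  assert (wfR : well_founded R).
  (* Lexicographic induction: on the rank, then on the image within the fibre. *)
  { assert (H : forall k l t, r t = k -> j k t = l -> Acc R t).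
    { intros k. induction (lt_wf k) as [k _ IHk].
      intros l. induction (lt_wf l) as [l _ IHl].
      intros t Ek El. constructor. intros s [L|[E L]].
      - apply (IHk (r s)) with (l := j (r s) s); congruence.
      - apply (IHl (j k s)); congruence. }
    intros t. eauto. }
  destruct (greedy_choice T K R wfR) as [h Hh].
  { intros t g.
    assert (Hs : small K (fun s => R s t)).
    { eapply small_subset.
      - apply (small_union K T (fun k => ~ lt (r t) k) (fun k s => r s = k)).
        + apply closed_segment_small.
        + intros i _. apply Hr.
      - intros s Hs. exists (r s). split; [|reflexivity].
        destruct Hs as [L|[E L]]; intros L'.
        + exact (lt_irrefl _ (lt_trans _ _ _ L L')).
        + rewrite E in L'. exact (lt_irrefl _ L'). }
    destruct (small_bounded _ (small_range _ _ g Hs)) as [x Hx].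
    exists x. intros s E. apply (lt_irrefl x), Hx. eauto. }
  exists h. intros s t E. apply NNPP. intros N.
  destruct (lt_total (r s) (r t)) as [L|[L|L]].
  - apply (Hh s t); [left; exact L|exact E].
  - destruct (lt_total (j (r t) s) (j (r t) t)) as [L'|[L'|L']].
    + apply (Hh s t); [right; auto|exact E].
    + apply N. apply (Ij (r t)); auto.
    + apply (Hh t s); [right; rewrite L; auto|congruence].
  - apply (Hh t s); [left; exact L|congruence].
Qed.

(** Rank a pair by its maximum: the pairs of maximum [k] lie in the square of a closed segment,
    which is a small union of small sets. *)
Lemma card_square_le : card_le (K * K) K.
Proof.
  apply (small_fibres_card_le _
    (fun p => if excluded_middle_informative (lt (fst p) (snd p)) then snd p else fst p)).
  intros k.
  eapply small_subset.
  - apply (small_union K (K * K) (fun a => ~ lt k a)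
      (fun a p => fst p = a /\ ~ lt k (snd p))).
    + apply closed_segment_small.
    + intros a _. apply (small_image _ _ _ _ (pair a) (closed_segment_small k)).
      intros [a' b] [E p]. simpl in *. subst. eauto.
  - intros [a b]. simpl.
    destruct (excluded_middle_informative (lt a b)) as [L|L]; intros <-.
    + exists a. repeat split; auto. intros L'. exact (lt_irrefl _ (lt_trans _ _ _ L L')).
    + exists a. repeat split; auto.
Qed.

(* A maximal disjoint family of injective copies of [K] in [T] leaves out a set of
   size at most [K]. *)
Lemma card_prod_absorb (T : Type) : card_le K T -> card_le (T * K) T.
Proof.
  intros [f1 Hf1].
  pose (P := fun F : (K -> T) -> Prop => (forall f, F f -> injective f) /\
    (forall f g a b, F f -> F g -> f a = g b -> f = g)).
  destruct (@classical_sets.Zorn_bigcup _ P) as [F [[PF1 PF2] Fmax]].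
  { intros Z HZ Htot. split.
    - intros f [F HF Ff]. exact (proj1 (HZ F HF) f Ff).
    - intros f g a b [F HF Ff] [G HG Gg].
      destruct (Htot F G HF HG) as [S|S].
      + apply (proj2 (HZ G HG)); auto.
      + apply (proj2 (HZ F HF)); auto. }
  destruct two_points as [k0 [k1 N01]].
  pose (R := fun t => forall f a, F f -> f a <> t).
  (* A copy of [K] among the leftover points could be added to the family, against maximality. *)
  assert (NR : ~ card_le K {t | R t}).
  { intros [u Hu]. pose (f0 := fun k => proj1_sig (u k)).
    assert (R0 : forall k, R (f0 k)) by (intros k; exact (proj2_sig (u k))).
    apply (Fmax (fun f => F f \/ f = f0)).
    - split.
      + intros f Hf. left. exact Hf.
      + intros S. apply (R0 k0 f0 k0); [|reflexivity]. apply S. right. reflexivity.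
    - split.
      + intros f [Hf| ->]; [auto|]. intros x y E. apply Hu, proj1_sig_injective, E.
      + intros f g a b [Hf| ->] [Hg| ->] E; eauto.
        * exfalso. exact (R0 b f a Hf E).
        * exfalso. exact (R0 a g b Hg (eq_sym E)). }
  assert (NF : exists f, F f).
  { apply NNPP. intros N. apply NR.
    assert (p : forall t, R t) by (intros t f a Hf; exfalso; eauto).
    exists (fun k => exist _ (f1 k) (p (f1 k))). intros x y E. apply Hf1.
    exact (f_equal (@proj1_sig _ _) E). }
  destruct NF as [fs Hfs].
  destruct (card_lt_card_le _ NR) as [v Hv].
  (* Each point gets a member of the family, a position in [K] and a tag: [k0] for a point lying on
     that member, [k1] for a leftover point, filed under [fs] at the position given by [v]. *)
  assert (Hd : forall t, exists z : {f | F f} * K * K,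
     (snd z = k0 /\ proj1_sig (fst (fst z)) (snd (fst z)) = t) \/
     (snd z = k1 /\ exists p : R t, v (exist _ t p) = snd (fst z))).
  { intros t. destruct (classic (R t)) as [p|N].
    - exists (exist _ fs Hfs, v (exist _ t p), k1). right. simpl. eauto.
    - apply not_all_ex_not in N. destruct N as [f N].
      apply not_all_ex_not in N. destruct N as [a N].
      apply imply_to_and in N. destruct N as [Hf N]. apply NNPP in N.
      exists (exist _ f Hf, a, k0). left. simpl. auto. }
  destruct (functional_choice _ Hd) as [d Fd].
  assert (Id : injective d).
  { intros s t E. destruct (Fd s) as [[E1 E2]|[E1 [p E2]]];
      destruct (Fd t) as [[E3 E4]|[E3 [q E4]]]; rewrite E in *; try congruence.
    rewrite <- E4 in E2. apply Hv in E2. exact (f_equal (@proj1_sig _ _) E2). }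
  destruct card_square_le as [q Hq].
  (* Position, tag and the extra factor are packed by [q] into one position on the same member;
     disjointness of the family makes the member recoverable. *)
  exists (fun tk => let z := d (fst tk) in
    proj1_sig (fst (fst z)) (q (q (snd (fst z), snd z), snd tk))).
  intros [s a] [t b]. simpl. intros E.
  destruct (d s) as [[[f Ff] x] y] eqn:Es. destruct (d t) as [[[g Fg] x'] y'] eqn:Et.
  simpl in E. assert (f = g) by eauto. subst g.
  apply (PF1 f Ff), Hq in E. injection E as E ->. apply Hq in E. injection E as -> ->.
  f_equal. apply Id. rewrite Es, Et. f_equal. f_equal. apply proj1_sig_injective.
  reflexivity.
Qed.

Lemma card_prod_bijection (T : Type) : card_le K T ->
  exists (f : T -> T * K) (g : T * K -> T), (forall x, g (f x) = x) /\ (forall y, f (g y) = y).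
Proof.
  intros H. apply card_le_bijection; [|apply card_prod_absorb, H].
  destruct two_points as [k _]. exists (fun t : T => (t, k)). intros x y E. congruence.
Qed.

Lemma card_prod_bool_bijection :
  exists (f : K * bool -> K) (g : K -> K * bool), (forall x, g (f x) = x) /\ (forall y, f (g y) = y).
Proof.
  apply card_le_bijection.
  - apply card_le_trans with (2 := card_square_le).
    destruct two_points as [a [b N]].
    exists (fun p : K * bool => (fst p, if snd p then a else b)).
    intros [x [|]] [y [|]]; simpl; intros E; congruence.
  - exists (fun k : K => (k, true)). intros x y E. congruence.
Qed.


(** * Spaces described by coordinates, and their continuous maps *)

(* [E d x y] means that the points [x] and [y] of [X] agree at coordinate [d] of [D];
   basic neighbourhoods of a point fix its values at a small set of coordinates. *)
Definition local {D X D' X' : Type} (E : D -> X -> X -> Prop) (E' : D' -> X' -> X' -> Prop)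
    (f : X -> X') : Prop :=
  forall x d', exists A : D -> Prop, small K A /\
    forall y, (forall d, A d -> E d y x) -> E' d' (f y) (f x).

Definition homeomorphic {D X D' X' : Type} (E : D -> X -> X -> Prop)
    (E' : D' -> X' -> X' -> Prop) : Prop :=
  exists (f : X -> X') (g : X' -> X),
    (forall x, g (f x) = x) /\ (forall y, f (g y) = y) /\ local E E' f /\ local E' E g.

Definition agree_at (D R : Type) (d : D) (x y : D -> R) : Prop := x d = y d.

(** The only coordinate is the point itself, so singletons are open: the discrete space. *)
Definition agree_discrete (S : Type) (_ : unit) (x y : S) : Prop := x = y.

Definition agree_pair {D X D' X' : Type} (E : D -> X -> X -> Prop)
    (E' : D' -> X' -> X' -> Prop) (d : D + D') (x y : X * X') : Prop :=
  match d with inl d => E d (fst x) (fst y) | inr d => E' d (snd x) (snd y) end.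

(** This is the [<K]-box power: by regularity a small set of pairs amounts to small sets of
    coordinates in a small set of factors. *)
Definition agree_power (I : Type) {D X : Type} (E : D -> X -> X -> Prop)
    (d : I * D) (x y : I -> X) : Prop := E (snd d) (x (fst d)) (y (fst d)).

Lemma local_single (D X D' X' : Type) (E : D -> X -> X -> Prop)
  (E' : D' -> X' -> X' -> Prop) (f : X -> X') :
  (forall x d', exists d, forall y, E d y x -> E' d' (f y) (f x)) -> local E E' f.
Proof.
  intros H x d'. destruct (H x d') as [d Hd]. exists (fun c => c = d).
  split; [apply small_singleton|]. auto.
Qed.

Lemma local_double (D X D' X' : Type) (E : D -> X -> X -> Prop)
  (E' : D' -> X' -> X' -> Prop) (f : X -> X') :
  (forall x d', exists d1 d2, forall y, E d1 y x -> E d2 y x -> E' d' (f y) (f x)) ->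
  local E E' f.
Proof.
  intros H x d'. destruct (H x d') as [d1 [d2 Hd]]. exists (fun c => c = d1 \/ c = d2).
  split; [apply small_or; apply small_singleton|]. auto.
Qed.

(** Each coordinate needed by [g] has a small support under [f], and a small union of these supports
    is small. *)
Lemma local_comp (D X D' X' D'' X'' : Type) (E : D -> X -> X -> Prop)
  (E' : D' -> X' -> X' -> Prop) (E'' : D'' -> X'' -> X'' -> Prop)
  (f : X -> X') (g : X' -> X'') :
  local E E' f -> local E' E'' g -> local E E'' (fun x => g (f x)).
Proof.
  intros Hf Hg x d. destruct (Hg (f x) d) as [A [sA HA]].
  destruct (functional_choice _ (Hf x)) as [B HB].
  exists (fun c => exists d', A d' /\ B d' c). split.
  - apply small_union; [exact sA|]. intros i _. apply HB.
  - intros y Hy. apply HA. intros d' Hd'. apply HB. eauto.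
Qed.

Lemma homeomorphic_sym (D X D' X' : Type) (E : D -> X -> X -> Prop)
  (E' : D' -> X' -> X' -> Prop) : homeomorphic E E' -> homeomorphic E' E.
Proof.
  intros [f [g [H1 [H2 [H3 H4]]]]]. exists g, f. auto.
Qed.

Lemma homeomorphic_trans (D X D' X' D'' X'' : Type) (E : D -> X -> X -> Prop)
  (E' : D' -> X' -> X' -> Prop) (E'' : D'' -> X'' -> X'' -> Prop) :
  homeomorphic E E' -> homeomorphic E' E'' -> homeomorphic E E''.
Proof.
  intros [f [g [H1 [H2 [H3 H4]]]]] [f' [g' [H1' [H2' [H3' H4']]]]].
  exists (fun x => f' (f x)), (fun y => g (g' y)). repeat split.
  - intros x. rewrite H1'. apply H1.
  - intros x. rewrite H2. apply H2'.
  - exact (local_comp _ _ _ _ _ _ _ _ _ _ _ H3 H3').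
  - exact (local_comp _ _ _ _ _ _ _ _ _ _ _ H4' H4).
Qed.

Lemma local_box_continuous (D R D' R' : Type) (f : (D -> R) -> (D' -> R')) :
  local (agree_at D R) (agree_at D' R') f -> box_continuous D R D' R' K f.
Proof.
  intros Hf V HV x Vx. destruct (HV (f x) Vx) as [A [sA HA]].
  destruct (functional_choice _ (Hf x)) as [B HB].
  exists (fun c => exists d', A d' /\ B d' c). split.
  - apply small_union; [exact sA|]. intros i _. apply HB.
  - intros y Hy. apply HA. intros d' Hd'. apply HB. intros d Hd. apply Hy. eauto.
Qed.

Lemma homeomorphic_box (D R D' R' : Type) :
  homeomorphic (agree_at D R) (agree_at D' R') -> box_homeomorphic D R D' R' K.
Proof.
  intros [f [g [H1 [H2 [H3 H4]]]]]. exists f, g.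
  repeat split; auto; apply local_box_continuous; assumption.
Qed.

(** * Homeomorphisms between powers and products *)

Lemma homeomorphic_reindex (D D' R : Type) (u : D -> D') (v : D' -> D) :
  (forall x, v (u x) = x) -> (forall y, u (v y) = y) ->
  homeomorphic (agree_at D R) (agree_at D' R).
Proof.
  intros H1 H2. exists (fun x d' => x (v d')), (fun y d => y (u d)). repeat split.
  - intros x. extensionality d. rewrite H1. reflexivity.
  - intros x. extensionality d. rewrite H2. reflexivity.
  - apply local_single. intros x d'. exists (v d'). intros y E. exact E.
  - apply local_single. intros x d. exists (u d). intros y E. exact E.
Qed.

Lemma homeomorphic_relabel (D R R' : Type) (u : R -> R') (v : R' -> R) :
  (forall x, v (u x) = x) -> (forall y, u (v y) = y) ->
  homeomorphic (agree_at D R) (agree_at D R').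
Proof.
  intros H1 H2. exists (fun x d => u (x d)), (fun y d => v (y d)). repeat split.
  - intros x. extensionality d. apply H1.
  - intros x. extensionality d. apply H2.
  - apply local_single. intros x d. exists d. intros y E. exact (f_equal u E).
  - apply local_single. intros x d. exists d. intros y E. exact (f_equal v E).
Qed.

Lemma homeomorphic_curry (D D' R : Type) :
  homeomorphic (agree_at (D * D') R) (agree_power D (agree_at D' R)).
Proof.
  exists (fun x d d' => x (d, d')), (fun y p => y (fst p) (snd p)). repeat split.
  - intros x. extensionality p. destruct p. reflexivity.
  - apply local_single. intros x [d d']. exists (d, d'). intros y E. exact E.
  - apply local_single. intros x d. exists d. intros y E. exact E.
Qed.

Lemma homeomorphic_power (I D X D' X' : Type) (E : D -> X -> X -> Prop)
  (E' : D' -> X' -> X' -> Prop) :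
  homeomorphic E E' -> homeomorphic (agree_power I E) (agree_power I E').
Proof.
  assert (L : forall D X D' X' (E : D -> X -> X -> Prop) (E' : D' -> X' -> X' -> Prop) f,
    local E E' f -> local (agree_power I E) (agree_power I E') (fun x i => f (x i))).
  { clear. intros D X D' X' E E' f Hf x [i d]. destruct (Hf (x i) d) as [A [sA HA]].
    exists (fun p => exists c, A c /\ (i, c) = p). split.
    - apply (small_image _ _ A _ (pair i) sA). auto.
    - intros y Hy. apply HA. intros c Hc. apply (Hy (i, c)). eauto. }
  intros [f [g [H1 [H2 [H3 H4]]]]].
  exists (fun x i => f (x i)), (fun y i => g (y i)). repeat split.
  - intros x. extensionality i. apply H1.
  - intros x. extensionality i. apply H2.
  - apply L, H3.
  - apply L, H4.
Qed.

Lemma homeomorphic_pair_r (D X D1 X1 D2 X2 : Type) (E : D -> X -> X -> Prop)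
  (E1 : D1 -> X1 -> X1 -> Prop) (E2 : D2 -> X2 -> X2 -> Prop) :
  homeomorphic E1 E2 -> homeomorphic (agree_pair E E1) (agree_pair E E2).
Proof.
  assert (L : forall D1 X1 D2 X2 (E1 : D1 -> X1 -> X1 -> Prop) (E2 : D2 -> X2 -> X2 -> Prop) f,
    local E1 E2 f ->
    local (agree_pair E E1) (agree_pair E E2) (fun p => (fst p, f (snd p)))).
  { clear D1 X1 D2 X2 E1 E2. intros D1 X1 D2 X2 E1 E2 f Hf [x x'] [d|d'].
    - exists (fun c => c = inl d). split; [apply small_singleton|].
      intros y Hy. apply (Hy (inl d) eq_refl).
    - destruct (Hf x' d') as [A [sA HA]].
      exists (fun p => exists c, A c /\ inr c = p). split.
      + apply (small_image _ _ A _ inr sA). auto.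
      + intros y Hy. apply HA. intros c Hc. apply (Hy (inr c)). eauto. }
  intros [f [g [H1 [H2 [H3 H4]]]]].
  exists (fun p => (fst p, f (snd p))), (fun p => (fst p, g (snd p))). repeat split.
  - intros [x y]. simpl. rewrite H1. reflexivity.
  - intros [x y]. simpl. rewrite H2. reflexivity.
  - apply L, H3.
  - apply L, H4.
Qed.

Lemma homeomorphic_power_pair (I S D X : Type) (E : D -> X -> X -> Prop) :
  homeomorphic (agree_power I (agree_pair (agree_discrete S) E))
               (agree_pair (agree_at I S) (agree_power I E)).
Proof.
  exists (fun x => (fun i => fst (x i), fun i => snd (x i))), (fun y i => (fst y i, snd y i)).
  repeat split.
  - intros x. extensionality i. symmetry. apply surjective_pairing.
  - intros [y z]. reflexivity.
  - apply local_single. intros x [i|[i d]]; [exists (i, inl tt)|exists (i, inr d)];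
      intros y H; exact H.
  - apply local_single. intros x [i [[]|d]]; [exists (inl i)|exists (inr (i, d))];
      intros y H; exact H.
Qed.

Lemma homeomorphic_zip (I R R' : Type) :
  homeomorphic (agree_pair (agree_at I R) (agree_at I R')) (agree_at I (R * R')).
Proof.
  exists (fun y i => (fst y i, snd y i)), (fun x => (fun i => fst (x i), fun i => snd (x i))).
  repeat split.
  - intros [y z]. reflexivity.
  - intros x. extensionality i. symmetry. apply surjective_pairing.
  - apply local_double. intros x i. exists (inl i), (inr i). intros y H H'.
    exact (f_equal2 pair H H').
  - apply local_single. intros x [i|i]; exists i; intros y H;
      [exact (f_equal fst H)|exact (f_equal snd H)].
Qed.

(** Used with [S'] equal to [K], which [S] absorbs, to split off a discrete factor [K]. *)
Lemma homeomorphic_discrete_assoc (S S' D X : Type) (E : D -> X -> X -> Prop)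
  (u : S -> S' * S) (v : S' * S -> S) :
  (forall x, v (u x) = x) -> (forall y, u (v y) = y) ->
  homeomorphic (agree_pair (agree_discrete S) E)
    (agree_pair (agree_discrete S') (agree_pair (agree_discrete S) E)).
Proof.
  intros H1 H2.
  exists (fun p => (fst (u (fst p)), (snd (u (fst p)), snd p))),
    (fun q => (v (fst q, fst (snd q)), snd (snd q))). repeat split.
  - intros [s x]. simpl. rewrite <- surjective_pairing, H1. reflexivity.
  - intros [s [t x]]. simpl. rewrite H2. reflexivity.
  - apply local_single. intros x [[]|[[]|d]]; [exists (inl tt)|exists (inl tt)|exists (inr d)];
      intros y H; [exact (f_equal (fun s => fst (u s)) H)
                  |exact (f_equal (fun s => snd (u s)) H)|exact H].
  - apply local_double. intros x [[]|d].
    + exists (inl tt), (inr (inl tt)). intros y H H'.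
      exact (f_equal v (f_equal2 pair H H')).
    + exists (inr (inr d)), (inr (inr d)). intros y H _. exact H.
Qed.

Lemma homeomorphic_of_splitting (M S : Type) :
  card_le K M -> card_le K S ->
  homeomorphic (agree_at K bool) (agree_pair (agree_discrete S) (agree_at K bool)) ->
  homeomorphic (agree_at M bool) (agree_at M K).
Proof.
  intros KM KS HS.
  destruct (card_prod_bijection M KM) as [u [v [uv vu]]].
  destruct (card_prod_bijection S KS) as [p [q [pq qp]]].
  destruct card_prod_bool_bijection as [c [d [cd dc]]].
  (* [2^K = S * 2^K = K * (S * 2^K) = K * 2^K]. *)
  assert (X1 : homeomorphic (agree_at K bool) (agree_pair (agree_discrete K) (agree_at K bool))).
  { eapply homeomorphic_trans; [exact HS|].
    eapply homeomorphic_trans; [|apply homeomorphic_pair_r, homeomorphic_sym, HS].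
    apply (homeomorphic_discrete_assoc S K _ _ _
             (fun s => (snd (p s), fst (p s))) (fun z => q (snd z, fst z))).
    - intros s. simpl. rewrite <- surjective_pairing. apply pq.
    - intros [k s]. simpl. rewrite qp. reflexivity. }
  (* [2^M = 2^(M * K) = (2^K)^M]. *)
  assert (X2 : homeomorphic (agree_at M bool) (agree_power M (agree_at K bool))).
  { eapply homeomorphic_trans; [|apply homeomorphic_curry].
    exact (homeomorphic_reindex _ _ _ u v uv vu). }
  eapply homeomorphic_trans; [exact X2|].
  eapply homeomorphic_trans; [apply homeomorphic_power, X1|].
  eapply homeomorphic_trans; [apply homeomorphic_power_pair|].
  eapply homeomorphic_trans; [apply homeomorphic_pair_r, homeomorphic_sym, X2|].
  eapply homeomorphic_trans; [apply homeomorphic_zip|].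
  exact (homeomorphic_relabel _ _ _ c d cd dc).
Qed.

(** * Splitting [2^K] along a cover without small subcover *)

Lemma least_element (P : K -> Prop) :
  (exists k, P k) -> exists k, P k /\ forall j, lt j k -> ~ P j.
Proof.
  intros [k Hk]. revert Hk. induction (lt_wf k) as [k _ IH]. intros Hk.
  destruct (classic (exists j, lt j k /\ P j)) as [[j [L Hj]]|N].
  - exact (IH j L Hj).
  - exists k. split; [exact Hk|]. intros j L Hj. apply N. eauto.
Qed.

(** The tail from [k] on has size [K], since otherwise [K] would be a union of two small sets. Below
    [k] the value of [e'] is arbitrary. *)
Lemma tail_bijection (k : K) : exists e e' : K -> K,
  (forall i, ~ lt (e i) k) /\ (forall i, e' (e i) = i) /\
  (forall j, ~ lt j k -> e (e' j) = j).
Proof.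
  assert (H : card_le K {j | ~ lt j k}).
  { apply NNPP. intros N. apply (small_or K _ _ (segment_small k) N).
    exists (fun x => exist _ x (classic (lt x k))). intros x y E.
    exact (f_equal (@proj1_sig _ _) E). }
  destruct (card_le_bijection _ _ H) as [f [g [H1 H2]]].
  { exists (@proj1_sig _ _). apply proj1_sig_injective. }
  exists (fun i => proj1_sig (f i)), (fun j =>
    match excluded_middle_informative (~ lt j k) with
    | left p => g (exist _ j p) | right _ => j end).
  assert (Q : forall i, ~ lt (proj1_sig (f i)) k) by (intros i; exact (proj2_sig (f i))).
  repeat split.
  - exact Q.
  - intros i. destruct (excluded_middle_informative _) as [p|N]; [|contradiction (N (Q i))].
    rewrite <- (H1 i) at 2. f_equal. apply proj1_sig_injective. reflexivity.
  - intros j Hj. destruct (excluded_middle_informative _) as [p|N]; [|contradiction].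
    rewrite H2. reflexivity.
Qed.

(* The minimal initial segments [x|k] whose basic open set lies in a member of the
   cover partition [2^K] into clopen sets, each of which is again a copy of [2^K]. *)
Lemma splitting_of_not_compact : ~ box_lt_compact K bool K ->
  exists S : Type, card_le K S /\
    homeomorphic (agree_at K bool) (agree_pair (agree_discrete S) (agree_at K bool)).
Proof.
  intros NC. apply not_all_ex_not in NC. destruct NC as [Cov NC].
  apply imply_to_and in NC. destruct NC as [Cop NC].
  apply imply_to_and in NC. destruct NC as [Ccov NC].
  pose (ag := fun k (x y : K -> bool) => forall j, lt j k -> y j = x j).
  pose (good := fun x k => exists U, Cov U /\ forall y, ag k x y -> U y).
  assert (Hr : forall x, exists k, good x k /\ forall j, lt j k -> ~ good x j).
  { intros x. apply least_element. destruct (Ccov x) as [U [CU Ux]].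
    destruct (Cop U CU x Ux) as [A [sA HA]].
    destruct (small_bounded A sA) as [k Hk]. exists k, U. split; [exact CU|].
    intros y Hy. apply HA. auto. }
  destruct (functional_choice _ Hr) as [r Fr].
  assert (good_ag : forall x y j k, ag k x y -> good x j -> (j = k \/ lt j k) -> good y j).
  { intros x y j k A [U [CU HU]] Hj. exists U. split; [exact CU|].
    intros z Hz. apply HU. intros i Hi. rewrite (Hz i Hi). apply A.
    destruct Hj as [->|Hj]; eauto. }
  (* If one of [r x], [r y] were smaller, agreement below [r x] would make it good for the other
     point too, against minimality. So [r] is constant on each piece. *)
  assert (r_ag : forall x y, ag (r x) x y -> r y = r x).
  { intros x y A. destruct (lt_total (r y) (r x)) as [L|[L|L]]; [|exact L|]; exfalso.
    - apply (proj2 (Fr x) _ L). apply (good_ag y x (r y) (r y)); [|apply Fr|auto].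
      intros j Hj. symmetry. apply A. eauto.
    - apply (proj2 (Fr y) _ L). apply (good_ag x y (r x) (r x)); [exact A|apply Fr|auto]. }
  (* Padding with [false] from [r x] on gives a canonical representative of the piece of [x]; the
     fixed points of [head] index the pieces. *)
  pose (head := fun (x : K -> bool) j =>
    if excluded_middle_informative (lt j (r x)) then x j else false).
  assert (head_lt : forall x j, lt j (r x) -> head x j = x j).
  { intros x j L. unfold head. destruct (excluded_middle_informative _); tauto. }
  assert (head_ag : forall x y, ag (r x) x y -> head y = head x).
  { intros x y A. extensionality j. unfold head. rewrite (r_ag x y A).
    destruct (excluded_middle_informative _); auto. }
  assert (r_head : forall x, r (head x) = r x).
  { intros x. apply r_ag. intros j L. auto. }
  assert (head_head : forall x, head (head x) = head x).
  { intros x. apply head_ag. intros j L. auto. }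
  pose (S := {x : K -> bool | head x = x}).
  exists S. split.
  (* With fewer than [K] pieces, one member of the cover for each piece would form a small
     subcover. *)
  - apply NNPP. intros NS. apply NC.
    assert (HU : forall s : S, exists U, Cov U /\
      forall y, ag (r (proj1_sig s)) (proj1_sig s) y -> U y).
    { intros s. apply (Fr (proj1_sig s)). }
    destruct (functional_choice _ HU) as [V HV].
    exists (fun U => exists s, V s = U). repeat split.
    + intros U [s <-]. apply HV.
    + apply small_range, NS.
    + intros x. exists (V (exist _ (head x) (head_head x))). split; [eauto|].
      apply HV. simpl. intros j L. rewrite r_head in L. symmetry. auto.
  - destruct (functional_choice _ tail_bijection) as [e He].
    destruct (functional_choice _ He) as [e' He'].
    (* A point is sent to its piece together with its tail, renumbered by [K]. *)
    pose (split_at := fun x => (exist _ (head x) (head_head x) : S, fun i => x (e (r x) i))).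
    pose (merge := fun (p : S * (K -> bool)) j =>
      if excluded_middle_informative (lt j (r (proj1_sig (fst p))))
      then proj1_sig (fst p) j else snd p (e' (r (proj1_sig (fst p))) j)).
    assert (merge_ag : forall p, ag (r (proj1_sig (fst p))) (proj1_sig (fst p)) (merge p)).
    { intros p j L. unfold merge. destruct (excluded_middle_informative _); tauto. }
    exists split_at, merge. repeat split.
    + intros x. extensionality j. unfold merge, split_at. simpl. rewrite r_head.
      destruct (excluded_middle_informative _) as [L|N]; [auto|].
      f_equal. apply (proj2 (proj2 (He' (r x)))). exact N.
    + intros p. assert (E := r_ag _ _ (merge_ag p)). unfold split_at. rewrite E.
      destruct p as [s y]. f_equal.
      * apply proj1_sig_injective. simpl. rewrite (head_ag _ _ (merge_ag (s, y))).
        apply (proj2_sig s).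
      * extensionality i. unfold merge. simpl.
        destruct (He' (r (proj1_sig s))) as [H1 [H2 _]].
        destruct (excluded_middle_informative _) as [L|N]; [destruct (H1 i L)|].
        rewrite H2. reflexivity.
    + intros x [[]|i].
      * exists (fun j => lt j (r x)). split; [apply segment_small|].
        intros y Hy. apply proj1_sig_injective. simpl. apply head_ag. exact Hy.
      * exists (fun j => lt j (r x) \/ j = e (r x) i).
        split; [apply small_or; [apply segment_small|apply small_singleton]|].
        intros y Hy. unfold agree_pair, agree_at, split_at; simpl.
        rewrite (r_ag x y); [apply Hy; auto|]. intros j L. apply Hy. auto.
    (* The discrete coordinate fixes the head and hence the cut, after which one tail coordinate
       settles the value at [j]. *)
    + apply local_double. intros p j.
      exists (inl tt), (inr (e' (r (proj1_sig (fst p))) j)). intros q H H'.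
      unfold agree_pair, agree_discrete, agree_at in *. unfold merge. rewrite H.
      destruct (excluded_middle_informative _); [reflexivity|exact H'].
Qed.

Lemma homeomorphic_of_not_compact (M : Type) : card_le K M ->
  ~ box_lt_compact K bool K -> homeomorphic (agree_at M bool) (agree_at M K).
Proof.
  intros KM NC. destruct (splitting_of_not_compact NC) as [S [KS HS]].
  exact (homeomorphic_of_splitting M S KM KS HS).
Qed.

(** * Consequences of compactness of [2^K] *)

Lemma compact_small_power (A : Type) :
  box_lt_compact K bool K -> card_lt A K -> card_lt (A -> bool) K.
Proof.
  intros Hc HA. destruct (card_lt_card_le A HA) as [e He].
  assert (Hx : forall p : A -> bool, exists x : K -> bool, forall a, x (e a) = p a).
  { intros p.
    assert (H : forall k, exists b, forall a, e a = k -> b = p a).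
    { intros k. destruct (classic (exists a, e a = k)) as [[a Ea]|N].
      - exists (p a). intros a' Ea'. f_equal. apply He. congruence.
      - exists true. intros a Ea. exfalso. eauto. }
    destruct (functional_choice _ H) as [x Fx]. exists x. intros a. auto. }
  destruct (Hc (fun U => exists p : A -> bool, forall x, U x <-> forall a, x (e a) = p a))
    as [Sub [HS [sS cS]]].
  - intros U [p Hp] x Ux. exists (fun k => exists a, e a = k).
    split; [apply small_range, HA|]. intros y Hy. apply Hp. intros a.
    rewrite Hy; [|eauto]. apply Hp, Ux.
  - intros x. exists (fun y => forall a, y (e a) = x (e a)). split; [|auto].
    exists (fun a => x (e a)). tauto.
  - apply card_le_lt_trans with (2 := sS).
    assert (HU : forall p : A -> bool, exists U : {U | Sub U},
      exists x, proj1_sig U x /\ forall a, x (e a) = p a).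
    { intros p. destruct (Hx p) as [x Ex]. destruct (cS x) as [U [SU Ux]].
      exists (exist _ U SU), x. auto. }
    destruct (functional_choice _ HU) as [V HV]. exists V. intros p q E.
    destruct (HV p) as [x [Vx Ex]], (HV q) as [y [Vy Ey]]. rewrite <- E in Vy.
    destruct (HS _ (proj2_sig (V p))) as [w Hw].
    extensionality a. rewrite <- Ex, <- Ey.
    rewrite (proj1 (Hw x) Vx), (proj1 (Hw y) Vy). reflexivity.
Qed.

(** Such points are determined by their restriction to [B]. *)
Lemma small_supported (D : Type) (B : D -> Prop) :
  box_lt_compact K bool K -> small K B ->
  small K (fun x : D -> bool => forall d, ~ B d -> x d = false).
Proof.
  intros Hc HB.
  apply card_le_lt_trans with (2 := compact_small_power _ Hc HB).
  exists (fun x b => proj1_sig x (proj1_sig b)). intros [x px] [y py] E.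
  apply proj1_sig_injective. simpl in *. extensionality d.
  destruct (classic (B d)) as [Hd|Hd].
  - exact (f_equal (fun f => f (exist _ d Hd)) E).
  - rewrite px, py; auto.
Qed.

Definition restrict {D : Type} (B : D -> Prop) (x : D -> bool) (d : D) : bool :=
  if excluded_middle_informative (B d) then x d else false.

Lemma restrict_in (D : Type) (B : D -> Prop) (x : D -> bool) d : B d -> restrict B x d = x d.
Proof. unfold restrict. destruct (excluded_middle_informative _); tauto. Qed.

Lemma restrict_out (D : Type) (B : D -> Prop) (x : D -> bool) d :
  ~ B d -> restrict B x d = false.
Proof. unfold restrict. destruct (excluded_middle_informative _); tauto. Qed.

(* [A] is a union of a [K]-chain of small sets, closed under taking the supports of two
   points that decide [c] differently and extend a given partial point; so it has size at
   most [K], and the values of [c] on points supported in [A] are decided within [A]. *)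
Lemma compact_no_continuous_surjection (D : Type) (c : (D -> bool) -> K) :
  box_lt_compact K bool K ->
  (forall x, exists A : D -> Prop, small K A /\
     forall y, (forall d, A d -> y d = x d) -> c y = c x) ->
  ~ (forall k, exists x, c x = k).
Proof.
  intros Hc Hcont Hsurj.
  destruct (functional_choice _ Hcont) as [N HN].
  destruct (functional_choice _ Hsurj) as [w Hw].
  (* The map [t] picks a point agreeing with [x] on [B] and with another value of [c] whenever there
     is one. Hence equality of the values means that [x] on [B] already decides [c]. *)
  assert (Ht : forall Bx : (D -> Prop) * (D -> bool), exists y : D -> bool,
    (forall d, fst Bx d -> y d = snd Bx d) /\
    (c y = c (snd Bx) -> forall z, (forall d, fst Bx d -> z d = snd Bx d) -> c z = c (snd Bx))).
  { intros [B x]. simpl.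
    destruct (classic (exists y, (forall d, B d -> y d = x d) /\ c y <> c x))
      as [[y [Hy Ny]]|Hn].
    - exists y. split; [exact Hy|]. contradiction.
    - exists x. split; [auto|]. intros _ z Hz. apply NNPP. intros Nz. apply Hn. eauto. }
  destruct (functional_choice _ Ht) as [t Ft].
  (* Stage [j] contributes the support of [w j], which keeps the value [j] attained, and the
     supports of [x] and [t (A j, x)] for every [x] vanishing off [A j]. *)
  destruct (well_founded_rec_predicate K D lt (fun k B d => N (w k) d \/
    exists x, (forall d, ~ B d -> x d = false) /\ (N x d \/ N (t (B, x)) d)) lt_wf) as [A HA].
  assert (sA : forall k, small K (A k)).
  { intros k. induction (lt_wf k) as [k _ IH].
    eapply small_subset; [|intros d; apply HA].
    apply small_union; [apply segment_small|]. intros j L.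
    apply small_or; [apply HN|]. apply small_union.
    - apply small_supported; auto.
    - intros x _. apply small_or; apply HN. }
  assert (mono : forall j k, lt j k -> forall d, A j d -> A k d).
  { intros j k L d Hd. apply HA. apply HA in Hd. destruct Hd as [i [Li Hi]]. eauto. }
  pose (A' := fun d => exists k, A k d).
  assert (Hdec : forall x, exists k, forall y, (forall d, A k d -> y d = restrict A' x d) ->
    c y = c (restrict A' x)).
  { intros x. set (F := restrict A' x). destruct (HN F) as [sF HF].
    (* Each coordinate of [N F] in [A'] enters at some stage; as [N F] is small, one stage [k] has
       them all. *)
    assert (Hk : exists k, forall d, N F d -> A' d -> A k d).
    { assert (Hrk : forall d, exists k, A' d -> A k d).
      { intros d. destruct (classic (A' d)) as [[k Hd]|Nd]; [eauto|].
        destruct two_points as [k _]. exists k. tauto. }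
      destruct (functional_choice _ Hrk) as [rk Frk].
      destruct (small_bounded (fun k => exists d, N F d /\ rk d = k)) as [k Hk].
      { apply (small_image _ _ (N F) _ rk sF). auto. }
      exists k. intros d Hd Ad. apply (mono (rk d)); eauto. }
    destruct Hk as [k Hk].
    pose (z := restrict (A k) x).
    assert (zout : forall d, ~ A k d -> z d = false) by (intros d; apply restrict_out).
    assert (zF : forall d, A k d -> z d = F d).
    { intros d Hd. unfold z, F. rewrite !restrict_in; auto. exists k. exact Hd. }
    destruct (lt_unbounded k) as [k' Lk].
    (* If [y] agrees with [F] on [A k] and its support lies in [A], then the supports of
       [y] and [F] are compatible. *)
    assert (Hcomp : forall y, (forall d, A k d -> y d = F d) -> (forall d, N y d -> A' d) ->
      c y = c F).
    { intros y Hy Ny.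
      (* [G] copies [F] on [N F] and [y] elsewhere. On the overlap of the two supports [y] and [F]
         agree, so [G] shares the values of both. *)
      pose (G := fun d => if excluded_middle_informative (N F d) then F d else y d).
      transitivity (c G).
      - symmetry. apply HN. intros d Hd. unfold G.
        destruct (excluded_middle_informative _); [|reflexivity]. symmetry. auto.
      - apply HF. intros d Hd. unfold G.
        destruct (excluded_middle_informative _); tauto. }
    destruct (Ft (A k, z)) as [T1 T2]. simpl in T1, T2.
    assert (cz : c z = c F).
    { apply Hcomp; [exact zF|]. intros d Hd. exists k'. apply HA. exists k. eauto 6. }
    (* The support of [t (A k, z)] lies in the next stage, so this point has the value [c z]. By the
       choice of [t], no point agreeing with [z] on [A k] has another value. *)
    exists k. intros y Hy. rewrite <- cz. apply T2.
    - rewrite cz. apply Hcomp.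
      + intros d Hd. rewrite T1; auto.
      + intros d Hd. exists k'. apply HA. exists k. eauto 6.
    - intros d Hd. rewrite Hy, zF; auto. }
  (* Rank each coordinate by a stage containing it: the fibres are small. *)
  assert (leA : card_le {d | A' d} K).
  { assert (Hrk : forall a : {d | A' d}, exists k, A k (proj1_sig a)).
    { intros [d Hd]. exact Hd. }
    destruct (functional_choice _ Hrk) as [rk Frk].
    apply (small_fibres_card_le _ rk). intros k.
    apply card_le_lt_trans with (2 := sA k).
    assert (q : forall a : {a | rk a = k}, A k (proj1_sig (proj1_sig a))).
    { intros [a Ea]. simpl. rewrite <- Ea. apply Frk. }
    exists (fun a => exist _ _ (q a)). intros a b E.
    apply proj1_sig_injective, proj1_sig_injective. exact (f_equal (@proj1_sig _ _) E). }
  destruct leA as [h Hh].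
  (* [pull] turns points of [2^K] into points supported in [A'], along the embedding [h]. *)
  pose (pull := fun (p : K -> bool) d =>
    match excluded_middle_informative (A' d) with
    | left q => p (h (exist _ d q)) | right _ => false end).
  assert (pull_restrict : forall p, restrict A' (pull p) = pull p).
  { intros p. extensionality d. unfold restrict, pull.
    destruct (excluded_middle_informative _); reflexivity. }
  assert (pull_onto : forall x, exists p, pull p = restrict A' x).
  { intros x.
    assert (H : forall k, exists b, forall a, h a = k -> b = x (proj1_sig a)).
    { intros k. destruct (classic (exists a, h a = k)) as [[a Ea]|Na].
      - exists (x (proj1_sig a)). intros a' Ea'. f_equal. f_equal. apply Hh. congruence.
      - exists true. intros a Ea. exfalso. eauto. }
    destruct (functional_choice _ H) as [p Fp]. exists p.
    extensionality d. unfold restrict, pull.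
    destruct (excluded_middle_informative _) as [q|]; [|reflexivity].
    apply (Fp _ (exist _ d q) eq_refl). }
  (* The level sets of [c] after [pull] form an open partition of [2^K]. *)
  destruct (Hc (fun U => exists k, forall p, U p <-> c (pull p) = k)) as [Sub [HS [sS cS]]].
  - intros U [k Hk] p Up. destruct (Hdec (pull p)) as [i Hi]. rewrite pull_restrict in Hi.
    exists (fun j => exists a, A i (proj1_sig a) /\ h a = j). split.
    + apply (small_image _ _ (fun a : {d | A' d} => A i (proj1_sig a)) _ h); [|auto].
      apply card_le_lt_trans with (2 := sA i).
      exists (fun a => exist (A i) (proj1_sig (proj1_sig a)) (proj2_sig a)). intros a b E.
      apply proj1_sig_injective, proj1_sig_injective. exact (f_equal (@proj1_sig _ _) E).
    + intros p' Hp'. apply Hk. rewrite (Hi (pull p')).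
      * apply Hk, Up.
      * intros d Hd. unfold pull. destruct (excluded_middle_informative _) as [q|]; [|reflexivity].
        apply Hp'. exists (exist _ d q). auto.
  - intros p. exists (fun y => c (pull y) = c (pull p)). split; [|reflexivity].
    exists (c (pull p)). tauto.
  - apply sS.
    (* Every level set is nonempty, because [A'] contains the support of [w k]; so a subcover has
       [K] members. *)
    assert (HU : forall k, exists U : {U | Sub U}, exists p, proj1_sig U p /\ c (pull p) = k).
    { intros k. destruct (pull_onto (w k)) as [p Ep]. destruct (cS p) as [U [SU Up]].
      exists (exist _ U SU), p. split; [exact Up|].
      rewrite Ep. transitivity (c (w k)); [|apply Hw]. apply HN.
      intros d Hd. apply restrict_in.
      destruct (lt_unbounded k) as [k' Lk]. exists k'. apply HA. exists k. auto. }
    destruct (functional_choice _ HU) as [V HV]. exists V. intros k l E.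
    destruct (HV k) as [p [Vp Ep]], (HV l) as [q [Vq Eq]]. rewrite <- E in Vq.
    destruct (HS _ (proj2_sig (V k))) as [m Hm].
    rewrite <- Ep, <- Eq, (proj1 (Hm p) Vp), (proj1 (Hm q) Vq). reflexivity.
Qed.

(** * The obstruction to a homeomorphism, and the equivalence *)

(** One coordinate of [K^M], read through the homeomorphism, is a continuous map of [2^M] to
    discrete [K]; constant functions show that it is onto. *)
Lemma not_compact_of_homeomorphic (M : Type) : card_le K M ->
  box_homeomorphic M bool M K K -> ~ box_lt_compact K bool K.
Proof.
  intros [u _] [f [g [_ [H2 [H3 _]]]]] Hc.
  destruct two_points as [k0 _].
  apply (compact_no_continuous_surjection M (fun x => f x (u k0)) Hc).
  - intros x.
    destruct (H3 (fun y => y (u k0) = f x (u k0))) with (x := x) as [A [sA HA]]; [|reflexivity|].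
    + intros y Hy. exists (fun d => d = u k0). split; [apply small_singleton|].
      intros z Hz. rewrite (Hz _ eq_refl). exact Hy.
    + exists A. split; [exact sA|]. intros y Hy. apply HA, Hy.
  - intros k. exists (g (fun _ => k)). rewrite H2. reflexivity.
Qed.

End SmallSets.

Theorem mainTheorem4 (K : Type) (ltK : K -> K -> Prop)
  (M : Type) (ltM : M -> M -> Prop)
  (HK : is_cardinal K ltK) (HKreg : regular K ltK)
  (HM : is_cardinal M ltM) (HMsing : singular M ltM)
  (Hcf : cofinality_is M ltM K) :
  box_homeomorphic M bool M K K <-> ~ weakly_compact K.
Proof.
  (* A cofinal subset of [M] of size [K] embeds [K] into [M]. *)
  assert (KM : card_le K M).
  { destruct Hcf as [[C [_ [_ H]]] _]. apply card_le_trans with (1 := H).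
    exists (@proj1_sig _ _). apply proj1_sig_injective. }
  split.
  - intros H [_ Hc]. exact (not_compact_of_homeomorphic K ltK HK HKreg M KM H Hc).
  - intros NW. apply (homeomorphic_box K ltK HK HKreg).
    apply (homeomorphic_of_not_compact K ltK HK HKreg M KM).
    intros Hc. apply NW. split; [exact (proj1 HKreg)|exact Hc].
Qed.
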